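(* Let $\mathcal{G}=(\mathcal{V},\mathcal{E})$ be a finite directed graph with positive edge weights and source set $S$, satisfying Assumption A1, and let $D(\cdot)$ be generated by the asynchronous adaptive Bellman--Ford algorithm from an arbitrary initial state $D(0)$, with event sequences and execution queues satisfying Assumption A2. Then the overestimate error satisfies $$\Delta^+(t)=0\qquad\text{for all } t\ge T_P^+ := P\,\mathcal{D}(\mathcal{G}).$$
   Context: Graph and distances. $\mathcal{G}=(\mathcal{V},\mathcal{E})$ is a finite directed graph with weights $e_{ij}>0$ for $(i,j)\in\mathcal{E}$; $S\subset\mathcal{V}$ (proper subset) is the source set; $\mathcal{N}(i)=\{j:(i,j)\in\mathcal{E}\}$. Assumption A1: from each $i\in\mathcal{V}$ there is a directed path to $S$. $d_i^*$ is the minimum of $\sum_{(v,v')\in\mathcal{P}}e_{vv'}$ over directed paths $\mathcal{P}$ from $i$ to a vertex of $S$ ($d_i^*=0$ for $i\in S$). The effective diameter $\mathcal{D}(\mathcal{G})$ is the maximum number of nodes in any shortest path (path attaining $d_i^*$) from any vertex $i\in\mathcal{V}$ to $S$. Algorithm. The state at time $t\in\{0,1,2,\dots\}$ is $D(t)=[\{d_i(t)\}_{i\in\mathcal{V}},\{m_{ij}(t)\}_{(i,j)\in\mathcal{E}},\{d_{ij}(t)\}_{(i,j)\in\mathcal{E}}]$, with entries in $\mathbb{R}\cup\{+\infty\}$. The possible actions are: Read$(i,j)$: $d_{ij}\leftarrow m_{ij}$; Update$(i)$: $d_i\leftarrow \min_{j\in\mathcal{N}(i)}(d_{ij}+e_{ij})$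 if $i\notin S$, and $d_i\leftarrow 0$ if $i\in S$; Write$(i,j)$: $m_{ij}\leftarrow d_j$. $D(0)$ is the initial state. For each $t\ge1$ there are sets $\mathcal{R}(t)\subseteq\mathcal{E}$, $\mathcal{U}(t)\subseteq\mathcal{V}$, $\mathcal{W}(t)\subseteq\mathcal{E}$ and an execution queue $\mathcal{Q}(t)$, i.e. an ordered list containing exactly once each of Read$(i,j)$ for $(i,j)\in\mathcal{R}(t)$, Update$(i)$ for $i\in\mathcal{U}(t)$, Write$(i,j)$ for $(i,j)\in\mathcal{W}(t)$, in arbitrary order. $D(t)$ is obtained from $D(t-1)$ by executing the instructions of $\mathcal{Q}(t)$ sequentially. Assumption A2: there are integers $P_R\ge0$, $P_U\ge1$, $P_W\ge0$ such that for all $t\geq 1$: $\bigcup_{k=0}^{\max(0,P_R-1)}\mathcal{R}(t+k)=\mathcal{E}$, $\bigcup_{k=0}^{P_U-1}\mathcal{U}(t+k)=\mathcal{V}$, $\bigcup_{k=0}^{\max(0,P_W-1)}\mathcal{W}(t+k)=\mathcal{E}$. Convention: $P_W=0$ additionally means that in each queue all Writes come after all Updates and before all Reads; $P_R=0$ additionally means that in each queue all Reads come after all non-Read instructions. The asynchrony measure is $P:=P_R+P_U+P_W$. Errors. $\Delta^+(t)$ is the maximum of $0$ and of all the numbers $d_i(t)-d_i^*$ ($i\in\mathcal{V}$), $m_{ij}(t)-d_j^*$ and $d_{ij}(t)-d_j^*$ ($(i,j)\in\mathcal{E}$). *)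

(* Defs.v *)
From HB Require Import structures.
From mathcomp Require Import all_boot all_order all_algebra.
From mathcomp Require Import constructive_ereal reals.

Set Implicit Arguments.
Unset Strict Implicit.
Unset Printing Implicit Defensive.

Import Order.TTheory GRing.Theory Num.Theory.
Local Open Scope ring_scope.

Section Graph.
Variables (R : realType) (V : finType).
Variables (E : {set V * V}) (e : V -> V -> R) (S : {set V}).

Definition edge : rel V := fun i j => (i, j) \in E.

Definition neighbors (i : V) : {set V} := [set j | edge i j].

(* As in [path], the vertices of the path are [i :: p].  Paths do not repeat
   vertices; since weights are positive, allowing repetitions changes neither
   the distances nor the shortest paths: see [dist_le_walk] and
   [shortest_walk_simple]. *)
Definition path_to (i : V) (p : seq V) : bool :=
  [&& path edge i p, uniq (i :: p) & last i p \in S].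

Definition path_weight (i : V) (p : seq V) : R :=
  \sum_(vw <- zip (i :: p) p) e vw.1 vw.2.

(* A path with [n.+1] distinct vertices has [n < #|V|]. *)
Definition dist (i : V) : \bar R :=
  \big[mine/+oo%E]_(n < #|V|) \big[mine/+oo%E]_(p : n.-tuple V | path_to i p)
    (path_weight i p)%:E.

Definition shortest_path (i : V) (p : seq V) : bool :=
  path_to i p && ((path_weight i p)%:E == dist i).

Definition eff_diam : nat :=
  \max_(i : V) \max_(n < #|V|) \max_(p : n.-tuple V | shortest_path i p)
    size (i :: p).

Definition reachability : Prop := forall i, exists p, path_to i p.

Lemma path_weight_cons i j p :
  path_weight i (j :: p) = e i j + path_weight j p.
Proof. by rewrite /path_weight /= big_cons. Qed.

Lemma path_to_size i p : path_to i p -> (size p < #|V|)%N.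
Proof. by case/and3P=> _ /card_uniqP /= <- _; exact: max_card. Qed.

Lemma dist_le_path i p : path_to i p -> (dist i <= (path_weight i p)%:E)%E.
Proof.
move=> pP; rewrite /dist (bigD1 (Ordinal (path_to_size pP))) //= ge_min.
by rewrite (bigD1 (in_tuple p)) //= ge_min lexx.
Qed.

Lemma dist_attained i p : path_to i p -> exists q, shortest_path i q.
Proof.
move=> /dist_le_path dp.
have [dN|[q qP dq]] : dist i = +oo%E \/
    exists2 q, path_to i q & dist i = (path_weight i q)%:E.
  pose K (x : \bar R) := x = +oo%E \/
    exists2 q, path_to i q & x = (path_weight i q)%:E.
  have Kmin x y : K x -> K y -> K (mine x y).
    by move=> Kx Ky; case: (leP x y).
  apply: (big_ind K) => [|//|n _]; first by left.
  by apply: (big_ind K) => [|//|q qP]; [left|right; exists q].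
- by move: dp; rewrite dN.
- by exists q; rewrite /shortest_path qP dq eqxx.
Qed.

Hypothesis e_gt0 : forall i j, (i, j) \in E -> 0 < e i j.

Lemma path_weight_ge0 i p : path edge i p -> 0 <= path_weight i p.
Proof.
elim: p i => [|j p IH] i /=; first by rewrite /path_weight big_nil.
case/andP=> /e_gt0 eij /IH; rewrite path_weight_cons; exact/addr_ge0/ltW.
Qed.

Lemma walk_shorten i p : path edge i p -> last i p \in S ->
  exists2 q, path_to i q &
    if uniq (i :: p) then q = p else path_weight i q < path_weight i p.
Proof.
have cut j q k : path_to j q -> k \in j :: q -> exists2 q', path_to k q' &
    path_weight k q' <= path_weight j q.
  elim: q j => [|x q IH] j jq.
    by rewrite inE => /eqP ->; exists [::].
  rewrite inE => /predU1P[->|kq]; first by exists (x :: q).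
  case/and3P: jq => /andP[/e_gt0 ejx pq] /andP[_ uq] lq.
  have [|q' q'P le'] := IH x _ kq; first by apply/and3P.
  by exists q' => //; rewrite path_weight_cons (le_trans le') ?lerDr ?ltW.
elim: p i => [|j p IH] i /=; first by move=> _ iS; exists [::]; rewrite /path_to.
case/andP=> eij pp lp; have [q qP] := IH j pp lp.
have e0 := e_gt0 eij.
case: ifPn => /= [up qp|/negPf-> lt_qp].
  rewrite {q}qp in qP; rewrite up andbT.
  have [ip|ip] /= := boolP (i \in j :: p); last first.
    by exists (j :: p); rewrite // /path_to /= eij pp ip up lp.
  have [q' q'P le'] := cut _ _ _ qP ip.
  by exists q' => //; rewrite path_weight_cons (le_lt_trans le') ?ltrDr.
rewrite andbF; have [iq|iq] := boolP (i \in j :: q).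
  have [q' q'P le'] := cut _ _ _ qP iq.
  by exists q' => //; rewrite path_weight_cons (le_lt_trans le') ?ltr_wpDl ?ltW.
exists (j :: q); last by rewrite !path_weight_cons ltrD2l.
by case/and3P: qP => pq /= uq lq; rewrite /path_to /= eij pq iq uq.
Qed.

Lemma dist_le_walk i p : path edge i p -> last i p \in S ->
  (dist i <= (path_weight i p)%:E)%E.
Proof.
move=> pp lp; have [q /dist_le_path dq] := walk_shorten pp lp.
case: ifP => _ => [<-//|lt_qp]; apply: (le_trans dq).
by rewrite lee_fin ltW.
Qed.

Lemma shortest_walk_simple i p : path edge i p -> last i p \in S ->
  (path_weight i p)%:E = dist i -> shortest_path i p.
Proof.
move=> pp lp dp; rewrite /shortest_path dp eqxx andbT /path_to pp lp andbT.
have [q /dist_le_path] := walk_shorten pp lp; rewrite -dp lee_fin.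
by case: ifP => // _ le_pq; rewrite ltNge le_pq.
Qed.

Lemma size_shortest_path i p :
  shortest_path i p -> (size (i :: p) <= eff_diam)%N.
Proof.
move=> pP; have lt_p := path_to_size (proj1 (andP pP)).
apply: leq_trans (leq_bigmax i).
apply: leq_trans (leq_bigmax (Ordinal lt_p)).
exact: (@leq_bigmax_cond _ _ (fun q : (size p).-tuple V => size (i :: q))
  (in_tuple p)).
Qed.

End Graph.

Section Algorithm.
Variables (R : realType) (V : finType).
Variables (E : {set V * V}) (e : V -> V -> R) (S : {set V}).

(* [mem_val] and [read_val] are the m_ij and d_ij; only their values on edges
   are meaningful. *)
Record state := State {
  est : V -> \bar R;
  mem_val : V * V -> \bar R;
  read_val : V * V -> \bar R }.

(* The entries of a state range over the reals and +oo. *)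
Definition admissible (D : state) : Prop :=
  [/\ forall i, est D i != -oo%E,
      forall ij, ij \in E -> mem_val D ij != -oo%E
    & forall ij, ij \in E -> read_val D ij != -oo%E].

Inductive action := Read of V * V | Update of V | Write of V * V.

Definition action_code (a : action) : (V * V) + (V + V * V) :=
  match a with
  | Read ij => inl ij | Update i => inr (inl i) | Write ij => inr (inr ij)
  end.

Definition action_decode (c : (V * V) + (V + V * V)) : action :=
  match c with
  | inl ij => Read ij | inr (inl i) => Update i | inr (inr ij) => Write ij
  end.

Lemma action_codeK : cancel action_code action_decode.
Proof. by case. Qed.

HB.instance Definition _ := Equality.copy action (can_type action_codeK).

Definition is_read (a : action) : bool := if a is Read _ then true else false.
Definition is_update (a : action) : bool :=
  if a is Update _ then true else false.
Definition is_write (a : action) : bool := if a is Write _ then true else false.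

Definition bellman (D : state) (i : V) : \bar R :=
  if i \in S then 0%E
  else \big[mine/+oo%E]_(j in neighbors E i) (read_val D (i, j) + (e i j)%:E)%E.

Definition exec (D : state) (a : action) : state :=
  match a with
  | Read ij =>
      State (est D) (mem_val D) [eta read_val D with ij |-> mem_val D ij]
  | Update i =>
      State [eta est D with i |-> bellman D i] (mem_val D) (read_val D)
  | Write ij =>
      State (est D) [eta mem_val D with ij |-> est D ij.2] (read_val D)
  end.

Fixpoint trajectory (D0 : state) (Q : nat -> seq action) (t : nat) : state :=
  if t is t'.+1 then foldl exec (trajectory D0 Q t') (Q t) else D0.

Definition is_queue (Rd : {set V * V}) (Up : {set V}) (Wr : {set V * V})
    (q : seq action) : bool :=
  perm_eq q ([seq Read ij | ij <- enum Rd] ++ [seq Update i | i <- enum Up]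
             ++ [seq Write ij | ij <- enum Wr]).

(* No [B]-action of [q] occurs before an [A]-action. *)
Definition all_before (A B : pred action) (q : seq action) : bool :=
  pairwise (fun a b => ~~ (B a && A b)) q.

Definition schedule (Rd : nat -> {set V * V}) (Up : nat -> {set V})
    (Wr : nat -> {set V * V}) (Q : nat -> seq action) : Prop :=
  forall t, (1 <= t)%N ->
    [/\ Rd t \subset E, Wr t \subset E & is_queue (Rd t) (Up t) (Wr t) (Q t)].

(* [n.-1] is truncated, i.e. it is max(0, n - 1). *)
Definition bounded_asynchrony (PR PU PW : nat) (Rd : nat -> {set V * V})
    (Up : nat -> {set V}) (Wr : nat -> {set V * V}) (Q : nat -> seq action) :
    Prop :=
  (1 <= PU)%N /\
  forall t, (1 <= t)%N ->
    [/\ \bigcup_(0 <= k < PR.-1.+1) Rd (t + k)%N = E,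
        \bigcup_(0 <= k < PU) Up (t + k)%N = [set: V],
        \bigcup_(0 <= k < PW.-1.+1) Wr (t + k)%N = E,
        PW = 0%N -> all_before is_update is_write (Q t) /\
                    all_before is_write is_read (Q t)
      & PR = 0%N -> all_before (predC is_read) is_read (Q t)].

Definition overestimate (D : state) : \bar R :=
  maxe (\big[maxe/0%E]_(i : V) (est D i - dist E e S i)%E)
    (maxe (\big[maxe/0%E]_(ij in E) (mem_val D ij - dist E e S ij.2)%E)
          (\big[maxe/0%E]_(ij in E) (read_val D ij - dist E e S ij.2)%E)).

End Algorithm.

(* Main.v *)
(* Call an entry of the state bounded when it is at most the distance it
   estimates.  Once the read values d_ij of the successors j on shortest paths
   are bounded, every later Update(i) produces a bounded estimate d_i, every
   later Write copies it to the m_ki and every later Read copies those to the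
   d_ki; none of these bounds is ever lost again.  This takes P_U + P_W + P_R
   steps, and it gains one node along the shortest paths, so P * D(G) steps
   suffice.  When P_W = 0 (or P_R = 0), the ordering of the queues puts the
   Write after the Update (or the Read after the Write) inside one queue, so
   that no further step is needed. *)
Require Import Defs.
From mathcomp Require Import all_boot all_order all_algebra.
From mathcomp Require Import constructive_ereal reals.

Set Implicit Arguments.
Unset Strict Implicit.
Unset Printing Implicit Defensive.

Import Order.TTheory GRing.Theory Num.Theory.

Local Open Scope ring_scope.

(** * Bellman equation along shortest paths, and the vanishing of the error *)

Section Distance.
Variables (R : realType) (V : finType).
Variables (E : {set V * V}) (e : V -> V -> R) (S : {set V}).
Hypothesis e_gt0 : forall i j, (i, j) \in E -> 0 < e i j.

Local Notation dist := (dist E e S).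
Local Notation shortest_path := (shortest_path E e S).

Lemma shortest_path_dist i p : shortest_path i p ->
  dist i = (path_weight e i p)%:E.
Proof. by case/andP=> _ /eqP. Qed.

(** Principle of optimality: a lighter continuation from [j], prefixed by [i], would be lighter than
    the shortest path from [i]. *)
Lemma shortest_path_cons i j p : shortest_path i (j :: p) ->
  [/\ edge E i j, shortest_path j p & dist i = (dist j + (e i j)%:E)%E].
Proof.
move=> ijp; have di := shortest_path_dist ijp.
have /andP[/and3P[/= /andP[ij jp] /andP[_ u] l] _] := ijp.
have jP : path_to E S j p by apply/and3P.
have [q jq] := dist_attained e jP.
have dj := shortest_path_dist jq.
have /andP[/and3P[qp _ ql] _] := jq.
have le_dj := dist_le_path e jP.
(* The sequence [j :: q] may pass through [i] again, so only the bound by walks applies. *)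
have le_di : (dist i <= (path_weight e i (j :: q))%:E)%E.
  by apply: dist_le_walk => //=; rewrite ij qp.
have eq_w : path_weight e j q = path_weight e j p.
  move: le_dj le_di; rewrite dj di !lee_fin !path_weight_cons lerD2l => h1 h2.
  by apply/eqP; rewrite eq_le h1 h2.
split => //; first by rewrite /Defs.shortest_path jP dj eq_w eqxx.
by rewrite di dj path_weight_cons eq_w -EFinD addrC.
Qed.

Lemma dist_ge0 i p : shortest_path i p -> (0 <= dist i)%E.
Proof.
move=> ip; rewrite (shortest_path_dist ip) lee_fin.
by case/andP: ip => /and3P[pp _ _] _; exact: path_weight_ge0 pp.
Qed.

Lemma overestimate_eq0 (D : state R V) :
  reachability E S ->
  (forall i, est D i <= dist i)%E ->
  (forall ij, ij \in E -> mem_val D ij <= dist ij.2)%E ->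
  (forall ij, ij \in E -> read_val D ij <= dist ij.2)%E ->
  overestimate E e S D = 0%E.
Proof.
move=> reach leA leM leR.
(* Reachability makes the distance finite, so it can be moved across the inequality. *)
have sub_le0 (x : \bar R) i : (x <= dist i)%E -> (x - dist i <= 0)%E.
  have [p /(dist_attained e)[q /shortest_path_dist ->]] := reach i.
  by move=> le_x; rewrite leeBlDr // add0e.
by rewrite /overestimate !bigmax_eq_id ?maxxx // => i => [iE|iE|_];
  apply: sub_le0; auto.
Qed.

End Distance.

(** * Membership in windows and queues *)

Lemma mem_bigcup_nat (T : finType) (F : nat -> {set T}) n x :
  x \in \bigcup_(0 <= k < n) F k -> exists2 k, (k < n)%N & x \in F k.
Proof. by rewrite big_mkord => /bigcupP[k _ xk]; exists k. Qed.

Lemma mem_queue (V : finType) A B C q (a : action V) : is_queue A B C q ->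
  (a \in q) =
  match a with
  | Read ij => ij \in A | Update i => i \in B | Write ij => ij \in C
  end.
Proof.
move=> /perm_mem ->; rewrite !mem_cat.
have inj_R : injective (@Read V) by move=> ? ? [].
have inj_U : injective (@Update V) by move=> ? ? [].
have inj_W : injective (@Write V) by move=> ? ? [].
have no (T : eqType) (f : T -> action V) b s : (forall x, f x <> b) ->
  (b \in [seq f x | x <- s]) = false.
  by move=> nf; apply/mapP => -[x _ /esym/nf].
by case: a => x; rewrite ?mem_map ?mem_enum // ?no ?orbF.
Qed.

(** * Invariants of the execution and chains of actions *)

Section Execution.
Variables (R : realType) (V : finType).
Variables (E : {set V * V}) (e : V -> V -> R) (S : {set V}).
Variables (Q : nat -> seq (action V)) (D0 : state R V).

Local Notation exec := (exec E e S).
Local Notation traj := (trajectory E e S D0 Q).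

Definition stable (P : state R V -> Prop) := forall D a, P D -> P (exec D a).

Lemma foldl_stable P D q : stable P -> P D -> P (foldl exec D q).
Proof. by move=> Pst; elim: q D => //= a q IH D PD; exact/IH/Pst. Qed.

Lemma traj_stable P t t' : stable P -> (t <= t')%N -> P (traj t) -> P (traj t').
Proof.
move=> Pst /subnK<-; elim: (t' - t)%N => //= n IH /IH; exact: foldl_stable.
Qed.

(* [P] is required right after [a], inside the queue: when P_W = 0 or P_R = 0,
   the next action that relies on [P] may be in the same queue. *)
Definition reached (a : action V) (P : state R V -> Prop) (T : nat) : Prop :=
  exists t q1 q2, [/\ (t < T)%N, Q t.+1 = q1 ++ a :: q2
                    & P (exec (foldl exec (traj t) q1) a)].

Lemma reached_traj a P T t : stable P -> reached a P T -> (T <= t)%N ->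
  P (traj t).
Proof.
move=> Pst [s [q1 [q2 [lt_sT Qs Pa]]]] le_Tt.
apply: (traj_stable Pst (leq_trans lt_sT le_Tt)).
by rewrite /= Qs foldl_cat /=; exact: (foldl_stable _ Pst).
Qed.

Lemma reached_first (a : action V) P P' T n : stable P -> P (traj T) ->
  (forall D, P D -> P' (exec D a)) ->
  (exists2 k, (k < n)%N & a \in Q (T.+1 + k)) ->
  reached a P' (T + n).
Proof.
move=> Pst PT PP' [k lt_kn]; rewrite addSn => aQ.
case/splitPr Qk: {1}(Q _) / aQ => [q1 q2].
exists (T + k)%N, q1, q2; split => //; first by rewrite ltn_add2l.
apply: PP'; apply: (foldl_stable _ Pst).
exact: (traj_stable Pst (leq_addr k T) PT).
Qed.

(** If [n] is positive, [P] persists up to time [T] and [b] occurs in the [n] queues that follow. If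
    [n] is zero, [b] occurs in the very queue of [a], and the ordering puts it after [a]. *)
Lemma reached_next (a b : action V) (A B : pred (action V)) P P' T n :
  stable P -> (forall D, P D -> P' (exec D b)) ->
  A a -> B b -> ~~ B a ->
  (forall t, (1 <= t)%N -> exists2 k, (k < n.-1.+1)%N & b \in Q (t + k)) ->
  (n = 0%N -> forall t, (1 <= t)%N -> all_before A B (Q t)) ->
  reached a P T -> reached b P' (T + n).
Proof.
move=> Pst PP' Aa Bb nBa window order aT.
case: n => [|n] in window order *; last first.
  apply: (reached_first Pst) => //; first exact: (reached_traj Pst aT).
  exact: window.
rewrite addn0; have [t [q1 [q2 [lt_tT Qt Pa]]]] := aT.
(* For [n = 0] the window has length [0.-1.+1 = 1], which forces the offset to be 0. *)
have [[|//] _] := window t.+1 isT; rewrite addn0.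
have := order erefl t.+1 isT; rewrite Qt /all_before pairwise_cat /=.
case/andP=> /allrelP ord _; rewrite mem_cat inE => /or3P[bq1|/eqP eq_b|bq2].
- by have := ord b a bq1 (mem_head _ _); rewrite Aa Bb.
- by rewrite -eq_b Bb in nBa.
case/splitPr: bq2 Qt => [q3 q4] Qt.
exists t, (q1 ++ a :: q3), q4; split => //; first by rewrite -catA.
by apply: PP'; rewrite foldl_cat /=; exact: (foldl_stable _ Pst).
Qed.

(** * Bounded entries and their propagation by single actions *)

Section Bounded.
Variable d : V -> \bar R.

(** The predicates [X], [Y], [Z] select the entries d_i, m_ij, d_ij already known to be bounded. *)
Definition bounded (X : V -> Prop) (Y Z : V * V -> Prop) (D : state R V) :=
  [/\ forall i, X i -> (est D i <= d i)%E,
      forall ij, Y ij -> (mem_val D ij <= d ij.2)%E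
    & forall ij, Z ij -> (read_val D ij <= d ij.2)%E].

(** What makes the outcome of Update(i) at most [d i]: on the source set the outcome is 0, elsewhere
    a successor attaining the Bellman equation must have a bounded read value. *)
Definition supported (Z : V * V -> Prop) (i : V) : Prop :=
  if i \in S then (0 <= d i)%E : Prop
  else exists j, [/\ edge E i j, Z (i, j) & d i = (d j + (e i j)%:E)%E].

Lemma bellman_le X Y Z D i : bounded X Y Z D -> supported Z i ->
  (bellman E e S D i <= d i)%E.
Proof.
move=> [_ _ leZ]; rewrite /supported /bellman.
case: ifP => // _ [j [ij Zij ->]].
rewrite (bigD1 j) /= ?inE // ge_min leeD2r //; exact: (leZ _ Zij).
Qed.

(** An entry not overwritten by [a] keeps its bound, and an overwritten one inherits it from its
    source. The primed predicates can thus gain only the entry that [a] writes. *)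
Lemma bounded_exec (X X' : V -> Prop) (Y Y' Z Z' : V * V -> Prop) D a :
  bounded X Y Z D ->
  (forall i, X' i -> supported Z i) ->
  (forall i, X' i -> X i \/ a = Update i) ->
  (forall ij, Y' ij -> X ij.2) ->
  (forall ij, Y' ij -> Y ij \/ a = Write ij) ->
  (forall ij, Z' ij -> Y ij) ->
  (forall ij, Z' ij -> Z ij \/ a = Read ij) ->
  bounded X' Y' Z' (exec D a).
Proof.
move=> bD X'Z X'X Y'X Y'Y Z'Y Z'Z; have [leX leY leZ] := bD.
split=> [i X'i|ij Y'ij|ij Z'ij].
- have [Xi|->] := X'X i X'i; last first.
    by rewrite /= eqxx; exact/(bellman_le bD)/X'Z.
  case: a {X'X Y'Y Z'Z} => [kl|k|kl] /=; try exact: leX.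
  by case: eqP => [<-|_]; [exact/(bellman_le bD)/X'Z|exact: leX].
- have [Yij|->] := Y'Y ij Y'ij; last by rewrite /= eqxx; exact/leX/Y'X.
  case: a {X'X Y'Y Z'Z} => [kl|k|kl] /=; try exact: leY.
  by case: eqP => [<-|_]; [exact/leX/Y'X|exact: leY].
- have [Zij|->] := Z'Z ij Z'ij; last by rewrite /= eqxx; exact/leY/Z'Y.
  case: a {X'X Y'Y Z'Z} => [kl|k|kl] /=; try exact: leZ.
  by case: eqP => [<-|_]; [exact/leY/Z'Y|exact: leZ].
Qed.

Lemma bounded_stable X (Y Z : V * V -> Prop) :
  (forall i, X i -> supported Z i) -> (forall ij, Y ij -> X ij.2) ->
  (forall ij, Z ij -> Y ij) -> stable (bounded X Y Z).
Proof. by move=> XZ YX ZY D a bD; apply: (bounded_exec bD); auto. Qed.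

Lemma supported_mono (Z Z' : V * V -> Prop) i :
  (forall ij, Z ij -> Z' ij) -> supported Z i -> supported Z' i.
Proof.
move=> ZZ'; rewrite /supported; case: ifP => // _ [j [ij Zij dij]].
by exists j; split=> //; exact: ZZ'.
Qed.

Variables (PR PU PW : nat) (Rd : nat -> {set V * V}) (Up : nat -> {set V}).
Variable (Wr : nat -> {set V * V}).
Hypothesis Q_schedule : schedule E Rd Up Wr Q.
Hypothesis asynchrony : bounded_asynchrony E PR PU PW Rd Up Wr Q.

Lemma update_window i t : (1 <= t)%N ->
  exists2 k, (k < PU)%N & Update i \in Q (t + k).
Proof.
move=> t1; have [_ /(_ t t1)[_ cover _ _ _]] := asynchrony.
have /mem_bigcup_nat[k lt_k iU] : i \in \bigcup_(0 <= k < PU) Up (t + k).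
  by rewrite cover inE.
have [_ _ q] := Q_schedule (leq_trans t1 (leq_addr k t)).
by exists k; rewrite ?(mem_queue _ q).
Qed.

Lemma write_window ij t : ij \in E -> (1 <= t)%N ->
  exists2 k, (k < PW.-1.+1)%N & Write ij \in Q (t + k).
Proof.
move=> ijE t1; have [_ /(_ t t1)[_ _ cover _ _]] := asynchrony.
have := ijE; rewrite -{1}cover => /mem_bigcup_nat[k lt_k ijW].
have [_ _ q] := Q_schedule (leq_trans t1 (leq_addr k t)).
by exists k; rewrite ?(mem_queue _ q).
Qed.

Lemma read_window ij t : ij \in E -> (1 <= t)%N ->
  exists2 k, (k < PR.-1.+1)%N & Read ij \in Q (t + k).
Proof.
move=> ijE t1; have [_ /(_ t t1)[cover _ _ _ _]] := asynchrony.
have := ijE; rewrite -{1}cover => /mem_bigcup_nat[k lt_k ijR].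
have [_ _ q] := Q_schedule (leq_trans t1 (leq_addr k t)).
by exists k; rewrite ?(mem_queue _ q).
Qed.

(** * One round of Update, Write and Read *)

Section Round.
Variables (X : V -> Prop) (Y Z : V * V -> Prop) (T : nat).
Hypothesis X_supported : forall i, X i -> supported Z i.
Hypothesis Y_X : forall ij, Y ij -> X ij.2.
Hypothesis Z_Y : forall ij, Z ij -> Y ij.
Hypothesis bounded_T : bounded X Y Z (traj T).

(** Only one vertex or edge is added at a time: different entries are refreshed at different times,
    so each is followed along its own chain Update, Write, Read. *)
Let X' i k := X k \/ k = i.
Let Y' ij kl := Y kl \/ kl = ij.
Let Z' ij kl := Z kl \/ kl = ij.

Let X'_supported i : supported Z i -> forall k, X' i k -> supported Z k.
Proof. by move=> iZ k [/X_supported|->]. Qed.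

Let stable_X i : supported Z i -> stable (bounded (X' i) Y Z).
Proof.
by move=> iZ; apply: bounded_stable => // [|ij Yij];
  [exact: X'_supported|left; exact: Y_X].
Qed.

Let stable_Y ij : supported Z ij.2 -> stable (bounded (X' ij.2) (Y' ij) Z).
Proof.
move=> iZ; apply: bounded_stable => [|kl [Ykl|->]|kl Zkl].
- exact: X'_supported.
- by left; exact: Y_X.
- by right.
- by left; exact: Z_Y.
Qed.

Let stable_Z ij : supported Z ij.2 ->
  stable (bounded (X' ij.2) (Y' ij) (Z' ij)).
Proof.
move=> iZ; apply: bounded_stable => [k Xk|kl [Ykl|->]|kl [Zkl|->]].
- by apply/(@supported_mono Z)/(X'_supported iZ Xk); left.
- by left; exact: Y_X.
- by right.
- by left; exact: Z_Y.
- by right.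
Qed.

Let reached_update i : supported Z i ->
  reached (Update i) (bounded (X' i) Y Z) (T + PU).
Proof.
move=> iZ; apply: (reached_first _ bounded_T) => [|D bD|].
- exact: bounded_stable.
- apply: (bounded_exec bD); auto.
    exact: X'_supported.
  by move=> k [|->]; auto.
- exact: update_window.
Qed.

Let reached_write ij : ij \in E -> supported Z ij.2 ->
  reached (Write ij) (bounded (X' ij.2) (Y' ij) Z) (T + PU + PW).
Proof.
move=> ijE iZ.
apply: (reached_next (A := @is_update V) (B := @is_write V)
  (stable_X iZ)) (reached_update iZ) => // [D bD|t|PW0 t t1].
- apply: (bounded_exec bD); auto.
  + exact: X'_supported.
  + by move=> kl [/Y_X Xl|->]; [left|right].
  + by move=> kl [|->]; auto.
- exact: write_window.
- by have [_ /(_ t t1)[_ _ _ /(_ PW0)[]]] := asynchrony.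
Qed.

Let reached_read ij : ij \in E -> supported Z ij.2 ->
  reached (Read ij) (bounded (X' ij.2) (Y' ij) (Z' ij)) (T + PU + PW + PR).
Proof.
move=> ijE iZ.
(* The Write that ends the previous chain is a non-Read action, so the ordering for P_R = 0 applies
   to it. *)
apply: (reached_next (A := predC (@is_read V)) (B := @is_read V)
  (stable_Y iZ)) (reached_write ijE iZ) => // [D bD|t|PR0 t t1].
- apply: (bounded_exec bD); auto.
  + exact: X'_supported.
  + by move=> kl [/Y_X Xl|->]; [left|right].
  + by move=> kl [/Z_Y Yl|->]; [left|right].
  + by move=> kl [|->]; auto.
- exact: read_window.
- by have [_ /(_ t t1)[_ _ _ _ /(_ PR0)]] := asynchrony.
Qed.

Lemma bounded_round t : (T + (PR + PU + PW) <= t)%N ->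
  bounded (supported Z) (fun ij => ij \in E /\ supported Z ij.2)
    (fun ij => ij \in E /\ supported Z ij.2) (traj t).
Proof.
move=> le_t.
have le_tR : (T + PU + PW + PR <= t)%N.
  by rewrite -(addnA T PU) -(addnA T) (addnC _ PR) (addnA PR).
split=> [i iZ|ij [ijE iZ]|ij [ijE iZ]].
- have le_tU : (T + PU <= t)%N.
    by apply: leq_trans le_tR; rewrite -addnA leq_addr.
  have [leX _ _] := reached_traj (stable_X iZ) (reached_update iZ) le_tU.
  by apply: leX; right.
- have [_ leY _] := reached_traj (stable_Z iZ) (reached_read ijE iZ) le_tR.
  by apply: leY; right.
- have [_ _ leZ] := reached_traj (stable_Z iZ) (reached_read ijE iZ) le_tR.
  by apply: leZ; right.
Qed.

End Round.
End Bounded.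
End Execution.

(** * Induction on the number of nodes of shortest paths *)

Section Levels.
Variables (R : realType) (V : finType).
Variables (E : {set V * V}) (e : V -> V -> R) (S : {set V}).
Hypothesis e_gt0 : forall i j, (i, j) \in E -> 0 < e i j.

Local Notation dist := (dist E e S).
Local Notation supported := (supported E e S dist).

(** Since [p] omits [i], the strict inequality says that the path has at most [l] nodes, the way
    [eff_diam] counts them. *)
Definition within (l : nat) (i : V) : Prop :=
  exists2 p, shortest_path E e S i p & (size p < l)%N.

Definition edge_within (l : nat) (ij : V * V) : Prop :=
  ij \in E /\ within l ij.2.

(** Removing the first vertex of a shortest path leaves a shortest path with one node less; outside
    [S] the path has such a first edge. *)
Lemma within_supported l i : within l.+1 i -> supported (edge_within l) i.
Proof.
move=> [p ip lt_pl]; rewrite /supported; case: ifPn => [_|iS].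
  exact: dist_ge0 ip.
case: p ip lt_pl => [|j p] ip lt_pl.
  by case/andP: ip => /and3P[_ _ /=]; rewrite (negPf iS).
have [ij jp di] := shortest_path_cons e_gt0 ip.
by exists j; split => //; split => //; exists p.
Qed.

Lemma withinS l i : within l i -> within l.+1 i.
Proof. by move=> [p ip lt_pl]; exists p => //; exact: leqW. Qed.

Variables (PR PU PW : nat) (Rd : nat -> {set V * V}) (Up : nat -> {set V}).
Variables (Wr : nat -> {set V * V}) (Q : nat -> seq (action V)).
Variable D0 : state R V.
Hypothesis Q_schedule : schedule E Rd Up Wr Q.
Hypothesis asynchrony : bounded_asynchrony E PR PU PW Rd Up Wr Q.

Lemma bounded_within l t : ((PR + PU + PW) * l <= t)%N ->
  bounded dist (within l) (edge_within l) (edge_within l)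
    (trajectory E e S D0 Q t).
Proof.
(* No path has fewer than 0 vertices after its start, so level 0 is empty and holds for any initial
   state. *)
elim: l t => [|l IH] t le_t; first by split=> [i|ij|ij] => [[]|[_ []]|[_ []]].
rewrite mulnS addnC in le_t.
have [] := bounded_round Q_schedule asynchrony _ _ _ (IH _ (leqnn _)) le_t.
- by move=> i /withinS; exact: within_supported.
- by move=> ij [].
- by [].
move=> leX leY leZ; split=> [i iw|ij [ijE iw]|ij [ijE iw]].
- exact/leX/within_supported.
- by apply: leY; split=> //; exact: within_supported.
- by apply: leZ; split=> //; exact: within_supported.
Qed.

Lemma within_eff_diam i : reachability E S -> within (eff_diam E e S) i.
Proof.
move=> /(_ i)[p /(dist_attained e)[q iq]]; exists q => //.
exact: size_shortest_path iq.
Qed.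

End Levels.

Theorem theorem3p5 (R : realType) (V : finType) (E : {set V * V})
    (e : V -> V -> R) (S : {set V}) (PR PU PW : nat)
    (Rd : nat -> {set V * V}) (Up : nat -> {set V}) (Wr : nat -> {set V * V})
    (Q : nat -> seq (action V)) (D0 : state R V)
    (e_gt0 : forall i j : V, (i, j) \in E -> 0 < e i j)
    (S_proper : S \proper [set: V])
    (reachable : reachability E S)
    (D0_admissible : admissible E D0)
    (Q_schedule : schedule E Rd Up Wr Q)
    (asynchrony : bounded_asynchrony E PR PU PW Rd Up Wr Q) (t : nat) :
  ((PR + PU + PW) * eff_diam E e S <= t)%N ->
  overestimate E e S (trajectory E e S D0 Q t) = 0%E.
Proof.
move=> le_t.
have [leX leY leZ] := bounded_within S e_gt0 D0 Q_schedule asynchrony le_t.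
apply: overestimate_eq0 => // [i|ij ijE|ij ijE].
- exact/leX/within_eff_diam.
- by apply: leY; split=> //; exact: within_eff_diam.
- by apply: leZ; split=> //; exact: within_eff_diam.
Qed.
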